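(* Let $p \ge 1$ be a real number. Consider the linear program: minimize $\bm{c}^{\top}\bm{x}$ subject to $\bm{A}\bm{x}=\bm{b}$, $\bm{x}\ge\bm{0}$, with $\bm{A}\in\mathbb{R}^{m\times n}$, $\bm{b}\in\mathbb{R}^m$, $\bm{c}\in\mathbb{R}^n$, under the standing assumptions listed in the context (in particular, the linear program is nondegenerate and the initial basic feasible solution $\bm{x}^0$ is not optimal). Then the simplex method with the $p$-norm rule, started from $\bm{x}^0$, finds an optimal solution in at most $$(n-m)\left\lceil m^{1+\frac{1}{p}}\, \frac{\gamma^2}{\delta^2}\, \log\left(\frac{m\gamma}{\delta}\right)\right\rceil$$ iterations.
   Context: Linear program and dictionaries. Put $\ell=n-m$. A basis is a set $B\subset\{1,\dots,n\}$ with $|B|=m$ such that the submatrix $\bm{A}_B$ of columns indexed by $B$ is nonsingular; $N=\{1,\dots,n\}\setminus B$ is the corresponding nonbasis. The dictionary for $B$ is: minimize $z_0+\bar{\bm{c}}_N^{\top}\bm{x}_N$ subject to $\bm{x}_B=\bar{\bm{b}}-\bar{\bm{A}}_N\bm{x}_N$, $\bm{x}\ge\bm{0}$, where $z_0=\bm{c}_B^{\top}\bm{A}_B^{-1}\bm{b}$, $\bar{\bm{c}}_N=\bm{c}_N-\bm{A}_N^{\top}(\bm{A}_B^{\top})^{-1}\bm{c}_B$ (reduced costs), $\bar{\bm{b}}=\bm{A}_B^{-1}\bm{b}$, $\bar{\bm{A}}_N=\bm{A}_B^{-1}\bm{A}_N$. Write $B=\{i_1,\dots,i_m\}$, $N=\{j_1,\dots,j_\ell\}$,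 $\bar{\bm{b}}=(\bar b_1,\dots,\bar b_m)^{\top}$, $\bar{\bm{c}}_N=(\bar c_1,\dots,\bar c_\ell)^{\top}$, $\bar{\bm{A}}_N=(\bar a_{ik})$. The basic solution of $B$ is $(\bm{x}_B,\bm{x}_N)=(\bar{\bm{b}},\bm{0})$; it is a basic feasible solution (BFS), and $B$ and $N$ are called feasible, if $\bar{\bm{b}}\ge\bm{0}$. Simplex method. Given a feasible dictionary, if $\bar{\bm{c}}_N\ge\bm{0}$ the current BFS is optimal and the method stops. Otherwise a pivoting rule chooses an entering variable $x_{j_s}$ with $\bar c_s<0$; its value is increased from $0$ to $\theta_s=\min\{\bar b_k/\bar a_{ks} : \bar a_{ks}>0,\ k=1,\dots,m\}$, and, with $r$ an index attaining this minimum, $x_{i_r}$ leaves the basis and $x_{j_s}$ enters it. This exchange is one iteration. $p$-norm rule. Let $(\bm{v}_N)_k$ be the $k$-th column of the $n\times\ell$ matrix $\bm{V}_N=\begin{bmatrix}-\bar{\bm{A}}_N\\ \bm{I}\end{bmatrix}$, with $\bm{I}$ the $\ell\times\ell$ identity, so $\|(\bm{v}_N)_k\|_p=(1+\sum_{i=1}^m|\bar a_{ik}|^p)^{1/p}$. The $p$-norm rule chooses the entering variable $x_{j_s}$ with $s\in\mathrm{argmin}_k\{\bar c_k/\|(\bm{v}_N)_k\|_p : k=1,\dots,\ell\}$. (For $p=2$ it is the steepest-edge rule.) Standing assumptions. $\mathrm{rank}\,\bm{A}=m$; an initial BFS $\bm{x}^0$ is available; the linear program and its dual (maximize $\bm{b}^{\top}\bm{y}$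 subject to $\bm{A}^{\top}\bm{y}+\bm{s}=\bm{c}$, $\bm{s}\ge\bm{0}$) have optimal basic solutions, with common optimal value $z^*$; $\bm{x}^0$ is not optimal, i.e. $\bm{c}^{\top}\bm{x}^0>z^*$; the linear program is nondegenerate, i.e. each basic variable has a positive value in every BFS. Further notation. $\gamma$ and $\delta$ are respectively the maximum and the minimum among all positive components of all BFSs. $\log$ is the natural logarithm.
   Formalization: The case m = 1 with γ = δ is excluded: there log(mγ/δ) = 0, so the bound is 0 iterations although x⁰ is not optimal, and the claim as stated is false (e.g. A = [1 1], b = 1, c = (0,1), x⁰ = (0,1)). *)

(* Defs.v *)
From HB Require Import structures.
From mathcomp Require Import all_boot all_order all_algebra.
From mathcomp Require Import all_classical all_reals all_analysis.

Set Implicit Arguments.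
Unset Strict Implicit.
Unset Printing Implicit Defensive.

Import Order.TTheory GRing.Theory Num.Theory.

Local Open Scope ring_scope.

(* The i-th element, in increasing order, of a set of k indices. *)
Definition set_elt n k (S : {set 'I_n}) (cS : #|S| = k) (i : 'I_k) : 'I_n :=
  enum_val (cast_ord (esym cS) i).

Record lp_basis (R : realType) m n (A : 'M[R]_(m, n)) := LpBasis {
  basic_set : {set 'I_n};
  basic_card : #|basic_set| = m;
  basic_unit : colsub (set_elt basic_card) A \in unitmx }.

Lemma nonbasic_card (R : realType) m n (A : 'M[R]_(m, n)) (B : lp_basis A) :
  #|~: basic_set B| = (n - m)%N.
Proof. by rewrite cardsCs finset.setCK card_ord basic_card. Qed.

(* B = {i_1, ..., i_m} and N = {j_1, ..., j_l}. *)
Definition bvar (R : realType) m n (A : 'M[R]_(m, n)) (B : lp_basis A)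
  (i : 'I_m) : 'I_n := set_elt (basic_card B) i.

Definition nvar (R : realType) m n (A : 'M[R]_(m, n)) (B : lp_basis A)
  (k : 'I_(n - m)) : 'I_n := set_elt (nonbasic_card B) k.

Definition basic_mx (R : realType) m n (A : 'M[R]_(m, n)) (B : lp_basis A) :
  'M[R]_m := colsub (bvar B) A.

Definition nonbasic_mx (R : realType) m n (A : 'M[R]_(m, n))
  (B : lp_basis A) : 'M[R]_(m, n - m) := colsub (nvar B) A.

Definition bbar (R : realType) m n (A : 'M[R]_(m, n)) (b : 'cV[R]_m)
  (B : lp_basis A) : 'cV[R]_m := invmx (basic_mx B) *m b.

Definition Abar (R : realType) m n (A : 'M[R]_(m, n)) (B : lp_basis A) :
  'M[R]_(m, n - m) := invmx (basic_mx B) *m nonbasic_mx B.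

Definition dual_solution (R : realType) m n (A : 'M[R]_(m, n))
  (c : 'cV[R]_n) (B : lp_basis A) : 'cV[R]_m :=
  invmx (basic_mx B)^T *m rowsub (bvar B) c.

Definition cbar (R : realType) m n (A : 'M[R]_(m, n)) (c : 'cV[R]_n)
  (B : lp_basis A) : 'cV[R]_(n - m) :=
  rowsub (nvar B) c -
  (nonbasic_mx B)^T *m dual_solution c B.

(* At most one term of the sum is present: x_B = bbar and x_N = 0. *)
Definition basic_solution (R : realType) m n (A : 'M[R]_(m, n))
  (b : 'cV[R]_m) (B : lp_basis A) : 'cV[R]_n :=
  \col_j \sum_(i < m | bvar B i == j) bbar b B i 0.

Definition feasible_basis (R : realType) m n (A : 'M[R]_(m, n))
  (b : 'cV[R]_m) (B : lp_basis A) : Prop := forall i, 0 <= bbar b B i 0.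

Definition nondegenerate_lp (R : realType) m n (A : 'M[R]_(m, n))
  (b : 'cV[R]_m) : Prop :=
  forall B : lp_basis A, feasible_basis b B -> forall i, 0 < bbar b B i 0.

Definition objective (R : realType) n (c x : 'cV[R]_n) : R :=
  (c^T *m x) 0 0.

Definition primal_feasible (R : realType) m n (A : 'M[R]_(m, n))
  (b : 'cV[R]_m) (x : 'cV[R]_n) : Prop :=
  A *m x = b /\ forall j, 0 <= x j 0.

Definition primal_optimal (R : realType) m n (A : 'M[R]_(m, n))
  (b : 'cV[R]_m) (c x : 'cV[R]_n) : Prop :=
  primal_feasible A b x /\
  forall x', primal_feasible A b x' -> objective c x <= objective c x'.

Definition dual_feasible (R : realType) m n (A : 'M[R]_(m, n))
  (c : 'cV[R]_n) (y : 'cV[R]_m) (s : 'cV[R]_n) : Prop :=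
  A^T *m y + s = c /\ forall j, 0 <= s j 0.

Definition dual_optimal (R : realType) m n (A : 'M[R]_(m, n))
  (b : 'cV[R]_m) (c : 'cV[R]_n) (y : 'cV[R]_m) (s : 'cV[R]_n) : Prop :=
  dual_feasible A c y s /\
  forall y' s', dual_feasible A c y' s' -> objective b y' <= objective b y.

(* The dual basic solution of B is y = A_B^-T c_B with slack s = c - A^T y,
   so that s_B = 0. *)
Definition has_optimal_value (R : realType) m n (A : 'M[R]_(m, n))
  (b : 'cV[R]_m) (c : 'cV[R]_n) (z : R) : Prop :=
  (exists B : lp_basis A, primal_optimal A b c (basic_solution b B) /\
     objective c (basic_solution b B) = z) /\
  (exists B : lp_basis A,
     let y := dual_solution c B in
     dual_optimal A b c y (c - A^T *m y) /\ objective b y = z).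

Definition bfs_positive_component (R : realType) m n (A : 'M[R]_(m, n))
  (b : 'cV[R]_m) : set R :=
  [set v | exists B : lp_basis A, exists j : 'I_n,
     [/\ feasible_basis b B, v = basic_solution b B j 0 & 0 < v]]%classic.

Definition is_maximum (R : realType) (S : set R) (g : R) : Prop :=
  S g /\ ubound S g.

Definition is_minimum (R : realType) (S : set R) (d : R) : Prop :=
  S d /\ lbound S d.

Definition pnorm (R : realType) (p : R) k (v : 'cV[R]_k) : R :=
  (\sum_i `|v i 0| `^ p) `^ p^-1.

Definition edge_mx (R : realType) m n (A : 'M[R]_(m, n)) (B : lp_basis A) :
  'M[R]_(m + (n - m), n - m) := col_mx (- Abar B) 1%:M.

Definition optimal_dictionary (R : realType) m n (A : 'M[R]_(m, n))
  (c : 'cV[R]_n) (B : lp_basis A) : Prop := forall k, 0 <= cbar c B k 0.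

Definition pnorm_entering (R : realType) (p : R) m n (A : 'M[R]_(m, n))
  (c : 'cV[R]_n) (B : lp_basis A) (s : 'I_(n - m)) : Prop :=
  cbar c B s 0 < 0 /\
  forall k, cbar c B s 0 / pnorm p (col s (edge_mx B))
            <= cbar c B k 0 / pnorm p (col k (edge_mx B)).

Definition leaving (R : realType) m n (A : 'M[R]_(m, n)) (b : 'cV[R]_m)
  (B : lp_basis A) (s : 'I_(n - m)) (r : 'I_m) : Prop :=
  0 < Abar B r s /\
  forall k, 0 < Abar B k s ->
    bbar b B r 0 / Abar B r s <= bbar b B k 0 / Abar B k s.

Definition exchange (R : realType) m n (A : 'M[R]_(m, n)) (B : lp_basis A)
  (s : 'I_(n - m)) (r : 'I_m) : {set 'I_n} :=
  (nvar B s |: (basic_set B :\ bvar B r))%SET.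

(* Whatever the choices among ties for the entering and the leaving variable,
   the method started from B never gets stuck (no entering variable, unbounded
   ray, singular new basis) and stops after at most t iterations at an optimal
   solution. *)
Fixpoint pnorm_simplex_solves (R : realType) (p : R) m n (A : 'M[R]_(m, n))
  (b : 'cV[R]_m) (c : 'cV[R]_n) (t : nat) (B : lp_basis A) : Prop :=
  (optimal_dictionary c B /\ primal_optimal A b c (basic_solution b B)) \/
  (~ optimal_dictionary c B /\
   if t is t'.+1 then
     (exists s, pnorm_entering p c B s) /\
     (forall s, pnorm_entering p c B s ->
        (exists r, leaving b B s r) /\
        (forall r, leaving b B s r ->
           exists B' : lp_basis A, basic_set B' = exchange B s r /\
             pnorm_simplex_solves p b c t' B'))
   else False).

(* Main.v *)
(* With s the slack of an optimal dual solution, the objective gap of a primal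
   feasible x is the sum over j of s_j x_j.  Two facts give the bound.
   (1) Each iteration contracts the gap by the factor 1 - 1/K, where
   K = m^(1+1/p) gamma^2/delta^2.  Let D be the largest value of -cbar_k / |v_k|.
   Expressing an optimal BFS in the current dictionary bounds the gap by
   D (m+1)^(1/p) (gamma/delta) m gamma, because a column with cbar_k < 0 has a
   pivot, and the BFS at the other end of that edge shows that its entries are at
   most gamma/delta; the step itself gains at least 2^(1/p) delta D, because the
   entering and the leaving variable both change by at least delta.
   (2) At a BFS with gap g > 0 some basic j has s_j >= g/(m gamma).  Since basic
   variables are at least delta, j cannot be basic once the gap is below
   g delta/(m gamma), which happens after ceil(K log(m gamma/delta)) iterations.
   Only n-m variables have s_j > 0, so there are at most n-m such phases. *)

Require Import Defs.
From HB Require Import structures.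
From mathcomp Require Import all_boot all_order all_algebra.
From mathcomp Require Import all_classical all_reals all_analysis.
From mathcomp Require Import ring lra.

Import Order.TTheory GRing.Theory Num.Theory.

Local Open Scope ring_scope.

(** * Dictionaries, basic solutions and edges of a basis *)

Section Bases.
Set Implicit Arguments.
Unset Strict Implicit.
Variables (R : realType) (m n : nat) (A : 'M[R]_(m, n)).
Implicit Types (B : lp_basis A) (x c : 'cV[R]_n) (b : 'cV[R]_m).

Lemma big_set_elt {V : nmodType} {k} {S : {set 'I_n}} (cS : #|S| = k)
    (F : 'I_n -> V) :
  \sum_(i < k) F (set_elt cS i) = \sum_(j in S) F j.
Proof.
case: k / cS; rewrite [RHS]big_enum_val.
by apply: eq_bigr => i _; rewrite /set_elt cast_ord_id.
Qed.

Lemma set_elt_in k (S : {set 'I_n}) (cS : #|S| = k) i : set_elt cS i \in S.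
Proof. exact: enum_valP. Qed.

Lemma set_elt_inj k (S : {set 'I_n}) (cS : #|S| = k) : injective (set_elt cS).
Proof. by move=> i j /enum_val_inj/cast_ord_inj. Qed.

Lemma set_eltP k (S : {set 'I_n}) (cS : #|S| = k) j :
  j \in S -> exists i, j = set_elt cS i.
Proof.
move=> jS; exists (cast_ord cS (enum_rank_in jS j)).
by rewrite /set_elt cast_ordK enum_rankK_in.
Qed.

Lemma sum_bvar_nvar {V : nmodType} B (F : 'I_n -> V) :
  \sum_j F j = \sum_i F (bvar B i) + \sum_k F (nvar B k).
Proof.
rewrite (big_set_elt (basic_card B)) (big_set_elt (nonbasic_card B)).
rewrite (bigID (mem (basic_set B))) /=; congr (_ + _).
by apply: eq_bigl => j; rewrite inE.
Qed.

Lemma bvar_in B i : bvar B i \in basic_set B.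
Proof. exact: set_elt_in. Qed.

Lemma nvar_notin B k : nvar B k \notin basic_set B.
Proof. by have := set_elt_in (nonbasic_card B) k; rewrite inE. Qed.

Lemma bvar_neq_nvar B i k : (bvar B i == nvar B k) = false.
Proof. by apply/eqP => E; have := nvar_notin B k; rewrite -E bvar_in. Qed.

Lemma bvar_eq B i j : (bvar B i == bvar B j) = (i == j).
Proof. exact/inj_eq/set_elt_inj. Qed.

Lemma nvar_eq B k l : (nvar B k == nvar B l) = (k == l).
Proof. exact/inj_eq/set_elt_inj. Qed.

Lemma basic_mx_unit B : basic_mx B \in unitmx.
Proof. exact: basic_unit. Qed.

Lemma mulmx_split B x :
  A *m x = basic_mx B *m rowsub (bvar B) x + nonbasic_mx B *m rowsub (nvar B) x.
Proof.
apply/colP => i; rewrite !mxE (sum_bvar_nvar B).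
by congr (_ + _); apply: eq_bigr => k _; rewrite !mxE.
Qed.

Lemma dictionary B b x : A *m x = b ->
  rowsub (bvar B) x = bbar b B - Abar B *m rowsub (nvar B) x.
Proof.
move=> <-; rewrite /bbar /Abar (mulmx_split B) mulmxDr mulKmx ?basic_mx_unit//.
by rewrite -mulmxA addrK.
Qed.

Lemma dictionaryE B b x i : A *m x = b ->
  x (bvar B i) 0 = bbar b B i 0 - \sum_k Abar B i k * x (nvar B k) 0.
Proof.
move=> /(dictionary B)/colP/(_ i); rewrite !mxE => ->; congr (_ - _).
by apply: eq_bigr => k _; rewrite !mxE.
Qed.

(** Converse of [dictionaryE]: multiplying the dictionary by [basic_mx B] restores the original
    equations, so [A *m x = b] can be checked coordinatewise. *)
Lemma dictionary_mul B b x :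
  (forall i,
     x (bvar B i) 0 = bbar b B i 0 - \sum_k Abar B i k * x (nvar B k) 0) ->
  A *m x = b.
Proof.
move=> xB; have {}xB :
    rowsub (bvar B) x = bbar b B - Abar B *m rowsub (nvar B) x.
  apply/colP => i; rewrite !mxE xB; congr (_ - _); rewrite ?mxE//.
  by apply: eq_bigr => k _; rewrite [rowsub _ _ _ _]mxE.
rewrite (mulmx_split B) xB /bbar /Abar mulmxBr mulKVmx ?basic_mx_unit//.
by rewrite -mulmxA mulKVmx ?basic_mx_unit// subrK.
Qed.

Lemma basic_solution_bvar b B i : basic_solution b B (bvar B i) 0 = bbar b B i 0.
Proof.
rewrite mxE (big_pred1 i)//= => j; exact: bvar_eq.
Qed.

Lemma basic_solution_notin b B j :
  j \notin basic_set B -> basic_solution b B j 0 = 0.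
Proof.
move=> jB; rewrite mxE big_pred0// => i.
by apply: contraNF jB => /eqP <-; exact: bvar_in.
Qed.

Lemma basic_solution_nvar b B k : basic_solution b B (nvar B k) 0 = 0.
Proof. exact/basic_solution_notin/nvar_notin. Qed.

Lemma mul_basic_solution b B : A *m basic_solution b B = b.
Proof.
apply: (@dictionary_mul B) => i; rewrite basic_solution_bvar big1 ?subr0// => k _.
by rewrite basic_solution_nvar mulr0.
Qed.

Lemma basic_solution_unique b B x : A *m x = b ->
  (forall j, j \notin basic_set B -> x j 0 = 0) -> x = basic_solution b B.
Proof.
move=> Ax x0; apply/colP => j.
have [jB|jB] := boolP (j \in basic_set B); last first.
  by rewrite x0// basic_solution_notin.
have [i ->] := set_eltP (basic_card B) jB.
rewrite basic_solution_bvar (dictionaryE _ _ Ax) big1 ?subr0// => k _.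
by rewrite x0 ?mulr0// nvar_notin.
Qed.

Lemma basic_solution_ge0 b B j : feasible_basis b B -> 0 <= basic_solution b B j 0.
Proof. by move=> fB; rewrite mxE sumr_ge0. Qed.

Lemma primal_feasible_basic b B :
  feasible_basis b B -> primal_feasible A b (basic_solution b B).
Proof.
move=> fB; split; first exact: mul_basic_solution.
by move=> j; exact: basic_solution_ge0.
Qed.

Lemma objectiveE c x : objective c x = \sum_j c j 0 * x j 0.
Proof. by rewrite /objective mxE; apply: eq_bigr => j _; rewrite mxE. Qed.

Lemma objective_dictionary c b B x : A *m x = b ->
  objective c x =
  objective c (basic_solution b B) + \sum_k cbar c B k 0 * x (nvar B k) 0.
Proof.
move=> Ax; rewrite !objectiveE !(sum_bvar_nvar B).
rewrite [X in _ + X + _]big1 ?addr0; last first.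
  by move=> k _; rewrite basic_solution_nvar mulr0.
have -> : \sum_k cbar c B k 0 * x (nvar B k) 0 =
    \sum_k c (nvar B k) 0 * x (nvar B k) 0 -
    \sum_i c (bvar B i) 0 * (\sum_k Abar B i k * x (nvar B k) 0).
  have -> : \sum_i c (bvar B i) 0 * (\sum_k Abar B i k * x (nvar B k) 0) =
     \sum_k ((nonbasic_mx B)^T *m dual_solution c B) k 0 * x (nvar B k) 0.
    under eq_bigr do rewrite mulr_sumr.
    rewrite exchange_big/=; apply: eq_bigr => k _.
    rewrite /dual_solution mulmxA -trmx_inv -trmx_mul -/(Abar B) mxE mulr_suml.
    by apply: eq_bigr => i _; rewrite !mxE mulrA; congr (_ * _); rewrite mulrC.
  rewrite -sumrB; apply: eq_bigr => k _.
  by rewrite -mulrBl; congr (_ * _); rewrite mxE [X in X + _]mxE [X in _ + X]mxE.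
rewrite addrA [RHS]addrAC; congr (_ + _).
rewrite -sumrB; apply: eq_bigr => i _.
by rewrite basic_solution_bvar (dictionaryE _ _ Ax); ring.
Qed.

(** The column [k] of [edge_mx B], reindexed by the original variables; the sum has at most one
    term. *)
Definition edge_dir B k : 'cV[R]_n :=
  \col_j ((j == nvar B k)%:R - \sum_(i | bvar B i == j) Abar B i k).

Lemma edge_dir_bvar B k i : edge_dir B k (bvar B i) 0 = - Abar B i k.
Proof.
rewrite mxE bvar_neq_nvar sub0r (big_pred1 i)// => j; exact: bvar_eq.
Qed.

Lemma edge_dir_nvar B k l : edge_dir B k (nvar B l) 0 = (l == k)%:R.
Proof.
rewrite mxE nvar_eq big_pred0 ?subr0// => i.
exact: bvar_neq_nvar.
Qed.

Lemma mul_edge_dir B k : A *m edge_dir B k = 0.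
Proof.
(* This is the dictionary with right-hand side 0, where [bbar] vanishes. *)
apply: (@dictionary_mul B) => i; rewrite edge_dir_bvar /bbar mulmx0 [X in X - _]mxE sub0r.
rewrite (bigD1 k)//= big1 => [|l lk]; rewrite edge_dir_nvar.
  by rewrite eqxx mulr1 addr0.
by rewrite (negbTE lk) mulr0.
Qed.

Definition edge_point b B k t := basic_solution b B + t *: edge_dir B k.

Lemma mul_edge_point b B k t : A *m edge_point b B k t = b.
Proof. by rewrite mulmxDr mul_basic_solution -scalemxAr mul_edge_dir scaler0 addr0. Qed.

Lemma edge_point_bvar b B k t i :
  edge_point b B k t (bvar B i) 0 = bbar b B i 0 - t * Abar B i k.
Proof.
by rewrite mxE [X in _ + X]mxE basic_solution_bvar edge_dir_bvar mulrN.
Qed.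

Lemma edge_point_nvar b B k t l :
  edge_point b B k t (nvar B l) 0 = t * (l == k)%:R.
Proof.
by rewrite mxE [X in _ + X]mxE basic_solution_nvar edge_dir_nvar add0r.
Qed.

Lemma objective_edge_point c b B k t :
  objective c (edge_point b B k t) =
  objective c (basic_solution b B) + t * cbar c B k 0.
Proof.
rewrite (objective_dictionary c B (mul_edge_point b B k t)).
congr (_ + _); rewrite (bigD1 k)//= big1 => [|l lk]; rewrite edge_point_nvar.
  by rewrite eqxx mulr1 addr0 mulrC.
by rewrite (negbTE lk) !mulr0.
Qed.

End Bases.

(** * Pivots: new bases, feasibility, and the choice of variables *)

Section Pivots.
Set Implicit Arguments.
Unset Strict Implicit.
Variables (R : realType) (m n : nat) (A : 'M[R]_(m, n)).
Implicit Types (B : lp_basis A) (x c : 'cV[R]_n) (b : 'cV[R]_m).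

(** Nonsingularity as a trivial kernel on vectors supported in [S], a form that a pivot can be
    checked against directly. *)
Lemma lp_basis_of_set (S : {set 'I_n}) : #|S| = m ->
  (forall x, A *m x = 0 -> (forall j, j \notin S -> x j 0 = 0) -> x = 0) ->
  exists B, basic_set B = S.
Proof.
move=> cS inj; suff uS : colsub (set_elt cS) A \in unitmx by exists (LpBasis uS).
rewrite -unitmx_tr -row_free_unit; apply: inj_row_free => v vA.
(* Extended by zero outside [S], [v] becomes a kernel vector of [A]. *)
pose x : 'cV[R]_n := \col_j \sum_(i | set_elt cS i == j) v 0 i.
have xE i : x (set_elt cS i) 0 = v 0 i.
  by rewrite mxE (big_pred1 i)// => j; exact/inj_eq/set_elt_inj.
have x_out j : j \notin S -> x j 0 = 0.
  move=> jS; rewrite mxE big_pred0// => i.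
  by apply: contraNF jS => /eqP <-; exact: set_elt_in.
suff x0 : x = 0 by apply/rowP => i; rewrite -xE x0 !mxE.
apply: inj => //; apply/colP => r; rewrite !mxE (bigID (mem S))/=.
rewrite [X in _ + X]big1 ?addr0; last by move=> j /x_out ->; rewrite mulr0.
rewrite -(big_set_elt cS (fun j => A r j * x j 0)).
have /rowP/(_ r) := vA; rewrite [RHS]mxE => vAr; rewrite -[RHS]vAr mxE.
by apply: eq_bigr => i _; rewrite xE !mxE mulrC.
Qed.

(** A kernel vector supported on the new set is a multiple of the edge direction [k]; as its
    coordinate [bvar B r] is zero, the nonzero pivot forces the multiple to be zero. *)
Lemma exchange_basis B k r : Abar B r k != 0 ->
  exists B', basic_set B' = exchange B k r.
Proof.
move=> a0; apply: lp_basis_of_set.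
  rewrite cardsU1 !inE (negbTE (nvar_notin B k)) andbF/= -[RHS](basic_card B).
  by rewrite [RHS](cardsD1 (bvar B r)) bvar_in.
move=> x Ax x_out.
have xN l : l != k -> x (nvar B l) 0 = 0.
  move=> lk; apply: x_out.
  by rewrite !inE nvar_eq (negbTE lk) (negbTE (nvar_notin B l)) andbF.
have xB i : x (bvar B i) 0 = - (Abar B i k * x (nvar B k) 0).
  rewrite (dictionaryE B i Ax) /bbar mulmx0 [X in X - _]mxE sub0r.
  by rewrite (bigD1 k)//= big1 ?addr0// => l /xN ->; rewrite mulr0.
have xk : x (nvar B k) 0 = 0.
  have /eqP : x (bvar B r) 0 = 0.
    by apply: x_out; rewrite !inE bvar_neq_nvar eqxx.
  by rewrite xB oppr_eq0 mulf_eq0 (negbTE a0)/= => /eqP.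
apply/colP => j; rewrite [RHS]mxE.
have [jB|jB] := boolP (j \in basic_set B).
  by have [i ->] := set_eltP (basic_card B) jB; rewrite [LHS]xB xk mulr0 oppr0.
have jN : j \in ~: basic_set B by rewrite inE.
have [l ->] := set_eltP (nonbasic_card B) jN.
by have [->|/xN] := eqVneq l k.
Qed.

(** At this step length the leaving variable reaches zero, so the edge point vanishes off the new
    basis and uniqueness identifies it. *)
Lemma exchange_edge_point b B B' k r : leaving b B k r ->
  basic_set B' = exchange B k r ->
  basic_solution b B' = edge_point b B k (bbar b B r 0 / Abar B r k).
Proof.
move=> [a_gt0 _] B'E; apply/esym/basic_solution_unique.
  exact: mul_edge_point.
move=> j; rewrite B'E !inE negb_or negb_and negbK => /andP[jk].
case/orP => [/eqP ->|jB].
  by rewrite edge_point_bvar divfK ?subrr ?gt_eqF.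
have jN : j \in ~: basic_set B by rewrite inE.
move: jk; have [l ->] := set_eltP (nonbasic_card B) jN.
by rewrite nvar_eq edge_point_nvar => /negbTE ->; rewrite mulr0.
Qed.

Lemma edge_point_ge0 b B k t : feasible_basis b B -> 0 <= t ->
  (forall i, t * Abar B i k <= bbar b B i 0) ->
  primal_feasible A b (edge_point b B k t).
Proof.
move=> fB t0 tA; split; first exact: mul_edge_point.
move=> j; have [jB|jB] := boolP (j \in basic_set B).
  by have [i ->] := set_eltP (basic_card B) jB; rewrite edge_point_bvar subr_ge0.
have jN : j \in ~: basic_set B by rewrite inE.
have [l ->] := set_eltP (nonbasic_card B) jN.
by rewrite edge_point_nvar mulr_ge0.
Qed.

Lemma exchange_feasible b B B' k r : feasible_basis b B ->
  leaving b B k r -> basic_set B' = exchange B k r -> feasible_basis b B'.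
Proof.
move=> fB lv B'E i; rewrite -basic_solution_bvar (exchange_edge_point lv B'E).
case: lv => a_gt0 ratio.
have t0 : 0 <= bbar b B r 0 / Abar B r k by rewrite divr_ge0// ltW.
apply: (edge_point_ge0 fB t0 _).2 => {}i.
(* Rows with a positive entry obey the ratio test; in the others the basic variable does not
   decrease. *)
have [a|a] := ltP 0 (Abar B i k).
  by rewrite -ler_pdivlMr// ratio.
by apply: le_trans (fB i); rewrite mulr_ge0_le0.
Qed.

Lemma leaving_exists b B k i : 0 < Abar B i k -> exists r, leaving b B k r.
Proof.
move=> ai; exists [arg min_(r < i | 0 < Abar B r k) (bbar b B r 0 / Abar B r k)]%O.
by case: arg_minP.
Qed.

Lemma optimal_dictionary_optimal b c B : feasible_basis b B ->
  optimal_dictionary c B -> primal_optimal A b c (basic_solution b B).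
Proof.
move=> fB oB; split; first exact: primal_feasible_basic.
move=> x [Ax x_ge0]; rewrite (objective_dictionary c B Ax) lerDl.
by rewrite sumr_ge0// => k _; rewrite mulr_ge0.
Qed.

(** The identity block contributes an entry 1. *)
Lemma pnorm_edge_gt0 (p : R) B k : 0 < pnorm p (col k (edge_mx B)).
Proof.
rewrite /pnorm powR_gt0// (bigD1 (rshift m k))//= ltr_pwDl//.
  by rewrite powR_gt0// normr_gt0 mxE col_mxEd mxE eqxx oner_neq0.
by rewrite sumr_ge0// => i _; exact: powR_ge0.
Qed.

Lemma pnorm_entering_exists (p : R) c B : ~ optimal_dictionary c B ->
  exists s, pnorm_entering p c B s.
Proof.
move=> /existsNP[k /negP]; rewrite -ltNge => ck.
pose F k := cbar c B k 0 / pnorm p (col k (edge_mx B)).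
(* The minimum is taken over all columns; it is negative because the quotient of [k] is, so the
   minimizer has negative cost. *)
have [s _ smin] := @arg_minP _ _ _ k xpredT F isT; exists s.
split; last by move=> l; exact: smin.
have := smin k isT; rewrite /F => /le_lt_trans H.
have : cbar c B s 0 / pnorm p (col s (edge_mx B)) < 0.
  by apply: H; rewrite pmulr_llt0// invr_gt0 pnorm_edge_gt0.
by rewrite pmulr_llt0// invr_gt0 pnorm_edge_gt0.
Qed.

End Pivots.

(** * Bounds on the p-norms of edge directions *)

Section Convergence.
Set Implicit Arguments.
Unset Strict Implicit.
Variables (R : realType) (p : R) (m n : nat) (A : 'M[R]_(m, n)).
Variables (b : 'cV[R]_m) (c : 'cV[R]_n) (zstar gamma delta : R).
Hypothesis p_ge1 : 1 <= p.
Implicit Types (B : lp_basis A) (x : 'cV[R]_n).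

Lemma sum_ord_le k (F : 'I_k -> R) a :
  (forall i, F i <= a) -> \sum_i F i <= k%:R * a.
Proof.
move=> Fa; rewrite -[in leRHS](card_ord k) mulr_natl -sumr_const.
by apply: ler_sum => i _; exact: Fa.
Qed.

Lemma pnorm_edgeE B k :
  pnorm p (col k (edge_mx B)) = (\sum_i `|Abar B i k| `^ p + 1) `^ p^-1.
Proof.
rewrite /pnorm big_split_ord/=; congr ((_ + _) `^ _).
  by apply: eq_bigr => i _; rewrite mxE col_mxEu [in LHS]mxE normrN.
rewrite (bigD1 k)//= big1 => [|l lk]; rewrite mxE col_mxEd [1%:M _ _]mxE.
  by rewrite eqxx normr1 powR1 addr0.
by rewrite (negbTE lk) normr0 powR0// gt_eqF// (lt_le_trans ltr01).
Qed.

Lemma powR_mulKV (a M : R) : 0 <= a -> 0 <= M ->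
  (a * M `^ p) `^ p^-1 = a `^ p^-1 * M.
Proof.
move=> a0 M0; rewrite powRM ?powR_ge0// -powRrM divff ?powRr1//.
by rewrite gt_eqF// (lt_le_trans ltr01).
Qed.

(** Each of the m + 1 terms is at most M^p; [1 <= M] covers the identity entry. *)
Lemma pnorm_edge_le B k M : 1 <= M -> (forall i, `|Abar B i k| <= M) ->
  pnorm p (col k (edge_mx B)) <= m.+1%:R `^ p^-1 * M.
Proof.
move=> M1 AM; have M0 := le_trans ler01 M1; have p0 := le_trans ler01 p_ge1.
have powR1p : 1 `^ p = 1 :> R by rewrite powR1.
rewrite pnorm_edgeE -powR_mulKV// ge0_ler_powR ?invr_ge0 ?nnegrE//.
- by rewrite addr_ge0// sumr_ge0// => i _; exact: powR_ge0.
- by rewrite mulr_ge0// powR_ge0.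
rewrite -natr1 mulrDl mul1r lerD//.
  by apply: sum_ord_le => i; rewrite ge0_ler_powR ?nnegrE.
by rewrite -[leLHS]powR1p ge0_ler_powR ?nnegrE.
Qed.

(** Only row [r] and the identity entry are kept; each contributes at least e^p. *)
Lemma pnorm_edge_ge B k r e : 0 <= e <= 1 -> e <= `|Abar B r k| ->
  2 `^ p^-1 * e <= pnorm p (col k (edge_mx B)).
Proof.
move=> /andP[e0 e1] eA; have p0 := le_trans ler01 p_ge1.
have powR1p : 1 `^ p = 1 :> R by rewrite powR1.
have sum0 (P : pred 'I_m) : 0 <= \sum_(i | P i) `|Abar B i k| `^ p.
  by rewrite sumr_ge0// => i _; exact: powR_ge0.
rewrite pnorm_edgeE -powR_mulKV// ge0_ler_powR ?invr_ge0 ?nnegrE//.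
- by rewrite mulr_ge0// powR_ge0.
- by rewrite addr_ge0.
rewrite mulr_natl mulr2n lerD//.
  by rewrite (bigD1 r)//= -[leLHS]addr0 lerD// ge0_ler_powR ?nnegrE.
by rewrite -[leRHS]powR1p ge0_ler_powR ?nnegrE.
Qed.

(** * Dual slack, and size bounds from nondegeneracy *)

Hypothesis optval : has_optimal_value A b c zstar.
Hypothesis nondeg : nondegenerate_lp A b.
Hypothesis gamma_max : is_maximum (bfs_positive_component A b) gamma.
Hypothesis delta_min : is_minimum (bfs_positive_component A b) delta.

Lemma optimal_value_le x : primal_feasible A b x -> zstar <= objective c x.
Proof.
by case: optval => -[B [[_ opt] <-]] _ xf; exact: opt.
Qed.

(** For the slack s of the optimal dual basic solution y, c^T x - b^T y = s^T x. This slack vanishes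
    on its basis, leaving at most n - m positive entries. *)
Lemma complementary_slack : exists s : 'cV[R]_n,
  [/\ forall j, 0 <= s j 0,
      (#|[set j | (0 < s j 0)%R]%SET| <= n - m)%N &
      forall x, A *m x = b -> objective c x - zstar = \sum_j s j 0 * x j 0].
Proof.
have [_ [B /= [[[_ s_ge0] _] zE]]] := optval.
exists (c - A^T *m dual_solution c B); split => // [|x Ax].
  rewrite -(nonbasic_card B) subset_leq_card//; apply/fintype.subsetP => j.
  rewrite !inE; apply: contraTN => /(set_eltP (basic_card B))[i ->].
  suff -> : (c - A^T *m dual_solution c B) (bvar B i) 0 = 0 by rewrite ltxx.
  have /colP/(_ i) : (basic_mx B)^T *m dual_solution c B = rowsub (bvar B) c.
    by rewrite /dual_solution mulKVmx// unitmx_tr basic_mx_unit.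
  rewrite [in X in _ = X -> _]mxE => cB; rewrite mxE -cB [X in _ + X]mxE.
  rewrite [X in X - _]mxE [X in _ - X]mxE; apply/eqP; rewrite subr_eq0.
  by apply/eqP; apply: eq_bigr => l _; rewrite !mxE.
rewrite -zE -objectiveE /objective linearB/= trmx_mul trmxK mulmxBl -mulmxA Ax.
rewrite [in RHS]mxE; congr (_ + _); rewrite [in RHS]mxE.
congr (- _); rewrite -[b in RHS]trmxK -trmx_mul [in RHS]mxE.
by [].
Qed.

Lemma delta_gt0 : 0 < delta. Proof. by case: delta_min => -[B [j []]]. Qed.

Lemma delta_le_gamma : delta <= gamma.
Proof. by case: delta_min => _; apply; case: gamma_max. Qed.

Lemma gamma_gt0 : 0 < gamma.
Proof. exact: lt_le_trans delta_gt0 delta_le_gamma. Qed.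

Lemma m_gt0 : (0 < m)%N.
Proof.
case: delta_min => -[B [j [_ -> gt0]]] _; rewrite lt0n; apply: contraTneq gt0 => m0.
rewrite mxE big1 ?ltxx// => i.
by suff : (i < 0)%N by []; rewrite -[X in (_ < X)%N]m0.
Qed.

(** Nondegeneracy makes every basic value of a BFS one of the positive components. *)
Lemma bbar_bounds B i : feasible_basis b B -> delta <= bbar b B i 0 <= gamma.
Proof.
move=> fB; have pos : bfs_positive_component A b (bbar b B i 0).
  by exists B, (bvar B i); split=> //; [rewrite basic_solution_bvar | exact: nondeg].
by case: delta_min gamma_max => _ dm [_ gm]; rewrite dm// gm.
Qed.

Lemma basic_solution_le B j : feasible_basis b B ->
  basic_solution b B j 0 <= gamma.
Proof.
move=> fB; have [jB|jB] := boolP (j \in basic_set B).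
  have [i ->] := set_eltP (basic_card B) jB.
  by rewrite basic_solution_bvar; case/andP: (bbar_bounds i fB).
by rewrite basic_solution_notin// ltW// gamma_gt0.
Qed.

Lemma leaving_of_negative_cost B k : feasible_basis b B -> cbar c B k 0 < 0 ->
  exists r, leaving b B k r.
Proof.
move=> fB ck; have [[i ai]|/forallNP a_le0] := pselect (exists i, 0 < Abar B i k).
  exact: leaving_exists ai.
set z := objective c (basic_solution b B).
have z_ge : zstar <= z by apply/optimal_value_le/primal_feasible_basic.
(* With no positive entry the whole ray is feasible; this [t] brings the objective down to
   [zstar - 1]. *)
pose t := (z - zstar + 1) / - cbar c B k 0.
have t0 : 0 <= t by rewrite divr_ge0 ?oppr_ge0 ?(ltW ck)// addr_ge0 ?subr_ge0.
have /optimal_value_le : primal_feasible A b (edge_point b B k t).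
  apply: edge_point_ge0 => // i; apply: le_trans (fB i).
  by rewrite mulr_ge0_le0// leNgt; apply/negP.
rewrite objective_edge_point -/z /t invrN mulrN mulNr divfK ?lt_eqF// => H.
exfalso; move: H; lra.
Qed.

(** [theta] is the new value of the entering variable, [theta * Abar B r k] the old value of the
    leaving one, and [theta * Abar B i k] the difference of two values in [0, gamma]. *)
Lemma exchange_bounds B B' k r : feasible_basis b B -> leaving b B k r ->
  basic_set B' = exchange B k r ->
  let theta := bbar b B r 0 / Abar B r k in
  [/\ delta <= theta, theta * Abar B r k >= delta &
      forall i, `|theta * Abar B i k| <= gamma].
Proof.
move=> fB lv B'E theta; have fB' := exchange_feasible fB lv B'E.
have xE := exchange_edge_point lv B'E; have [a_gt0 _] := lv; split.
- have kB' : nvar B k \in basic_set B' by rewrite B'E !inE eqxx.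
  have [i ki] := set_eltP (basic_card B') kB'.
  have := edge_point_nvar b B k theta k; rewrite eqxx mulr1 => <-.
  rewrite -xE ki basic_solution_bvar; by case/andP: (bbar_bounds i fB').
- by rewrite divfK ?gt_eqF//; case/andP: (bbar_bounds r fB).
move=> i; have -> : theta * Abar B i k =
    bbar b B i 0 - basic_solution b B' (bvar B i) 0.
  by rewrite xE edge_point_bvar -/theta opprB addrC subrK.
have := basic_solution_ge0 (bvar B i) fB'.
have := basic_solution_le (bvar B i) fB'.
have := fB i; have /andP[_] := bbar_bounds i fB.
by move=> *; rewrite ler_norml; apply/andP; split; lra.
Qed.

(** * The optimality gap and its contraction *)

Definition gap B := objective c (basic_solution b B) - zstar.

Lemma gap_exchange B B' k r : leaving b B k r -> basic_set B' = exchange B k r ->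
  gap B' = gap B + bbar b B r 0 / Abar B r k * cbar c B k 0.
Proof.
move=> lv B'E; rewrite /gap (exchange_edge_point lv B'E) objective_edge_point.
by rewrite addrAC.
Qed.

Lemma gap_ge0 B : feasible_basis b B -> 0 <= gap B.
Proof.
by move=> fB; rewrite subr_ge0; apply/optimal_value_le/primal_feasible_basic.
Qed.

(** By nondegeneracy, a pivot on a negative cost has positive length and would make the gap
    negative. *)
Lemma optimal_of_gap0 B : feasible_basis b B -> gap B <= 0 ->
  optimal_dictionary c B.
Proof.
move=> fB g0 k; rewrite leNgt; apply/negP => ck.
have [r lv] := leaving_of_negative_cost fB ck; have [a_gt0 _] := lv.
have [B' B'E] := exchange_basis (lt0r_neq0 a_gt0).
have := gap_ge0 (exchange_feasible fB lv B'E); rewrite (gap_exchange lv B'E).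
apply/negP; rewrite -ltNge.
have : bbar b B r 0 / Abar B r k * cbar c B k 0 < 0.
  by rewrite pmulr_rlt0// divr_gt0// nondeg.
lra.
Qed.

(* The constant K of the header. *)
Definition rate := m%:R `^ (1 + p^-1) * (gamma ^+ 2 / delta ^+ 2).

Lemma rate_ge1 : 1 <= rate.
Proof.
have d0 := delta_gt0; have dg := delta_le_gamma.
rewrite /rate -[leLHS]mulr1 ler_pM//.
  rewrite -[leLHS](powRr0 m%:R) ler_powR// ?ler1n ?m_gt0//.
  by rewrite addr_ge0// invr_ge0 (le_trans ler01).
by rewrite ler_pdivlMr ?exprn_gt0// mul1r lerXn2r// nnegrE ltW// gamma_gt0.
Qed.

(** Compares the factors of D in the upper bound on the gap and the lower bound on the decrease; the
    point is m + 1 <= 2m. *)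
Lemma rate_factor : m.+1%:R `^ p^-1 * (gamma / delta) * (m%:R * gamma) <=
  rate * (2 `^ p^-1 * delta).
Proof.
have d0 := delta_gt0; have g0 := gamma_gt0.
have m0 : 0 < m%:R :> R by rewrite ltr0n m_gt0.
have ip0 : 0 <= p^-1 by rewrite invr_ge0 (le_trans ler01).
have key : m.+1%:R `^ p^-1 <= m%:R `^ p^-1 * 2 `^ p^-1.
  rewrite -powRM ?ler0n// ge0_ler_powR ?nnegrE ?mulr_ge0//.
  by rewrite -natrM ler_nat muln2 -addnn -addn1 leq_add2l m_gt0.
rewrite /rate powRD; last by rewrite gt_eqF ?implybT// ltr_pwDl.
rewrite powRr1; last exact: ltW.
have -> : m%:R * m%:R `^ p^-1 * (gamma ^+ 2 / delta ^+ 2) * (2 `^ p^-1 * delta) =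
  m%:R `^ p^-1 * 2 `^ p^-1 * (gamma / delta) * (m%:R * gamma).
  by field; rewrite gt_eqF.
by rewrite ler_pM2r ?mulr_gt0// ler_pM2r ?divr_gt0.
Qed.

Lemma entering_cost_le B s k : pnorm_entering p c B s ->
  - cbar c B k 0 <= - cbar c B s 0 / pnorm p (col s (edge_mx B)) *
                    pnorm p (col k (edge_mx B)).
Proof.
case=> _ /(_ k); rewrite mulNr mulNr lerN2.
by rewrite ler_pdivlMr ?pnorm_edge_gt0.
Qed.

Lemma gap_contraction B B' s r : feasible_basis b B -> pnorm_entering p c B s ->
  leaving b B s r -> basic_set B' = exchange B s r ->
  gap B' <= (1 - rate^-1) * gap B.
Proof.
move=> fB es lv B'E; have [cs _] := es; rewrite (gap_exchange lv B'E).
have d0 := delta_gt0; have g0 := gamma_gt0; have dg := delta_le_gamma.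
set theta := _ / _; set S := pnorm p (col s (edge_mx B)).
have S0 : 0 < S := pnorm_edge_gt0 p B s.
pose D := - cbar c B s 0 / S.
have D0 : 0 < D by rewrite divr_gt0// oppr_gt0.
have [dt dta ta_le] := exchange_bounds fB lv B'E; rewrite -/theta in dt dta ta_le.
have t0 : 0 < theta := lt_le_trans d0 dt.
(* The pivot entry is at least e = delta / theta <= 1; the theta in e cancels against the step
   length. *)
have decrease : 2 `^ p^-1 * delta * D <= - (theta * cbar c B s 0).
  have : 2 `^ p^-1 * (delta / theta) <= S.
    apply: (@pnorm_edge_ge _ _ r).
      by rewrite divr_ge0 ?(ltW d0) ?(ltW t0)//= ler_pdivrMr// mul1r.
    by rewrite ler_pdivrMr// mulrC (le_trans dta)// ler_wpM2l// ?(ltW t0)// ler_norm.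
  rewrite mulrA ler_pdivrMr// => H.
  have -> : - (theta * cbar c B s 0) = S * theta * D.
    by rewrite /D; field; rewrite gt_eqF.
  by rewrite ler_wpM2r// ltW.
have gap_le : gap B <= m.+1%:R `^ p^-1 * (gamma / delta) * (m%:R * gamma) * D.
  have [[Bs [[[Axs xs_ge0] _] zE]] _] := optval.
  set xs := basic_solution b Bs in Axs xs_ge0 zE.
  have fBs : feasible_basis b Bs.
    by move=> i; rewrite -basic_solution_bvar.
  have -> : gap B = \sum_k - cbar c B k 0 * xs (nvar B k) 0.
    rewrite /gap -zE (objective_dictionary c B Axs).
    by rewrite opprD addNKr -sumrN; apply: eq_bigr => k _; rewrite mulNr.
  set W := m.+1%:R `^ p^-1 * (gamma / delta).
  have W0 : 0 <= W by rewrite mulr_ge0 ?powR_ge0// divr_ge0 ?ltW.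
  (* Columns with nonnegative cost contribute at most 0, so norms need a bound only where the cost
     is negative. *)
  have cost_le k : - cbar c B k 0 * xs (nvar B k) 0 <= D * W * xs (nvar B k) 0.
    rewrite ler_wpM2r//; have [ck|ck] := leP 0 (cbar c B k 0).
      by rewrite (@le_trans _ _ 0) ?oppr_le0// mulr_ge0// ltW.
    have : - cbar c B k 0 <= D * pnorm p (col k (edge_mx B)).
      exact: entering_cost_le.
    move=> /le_trans; apply; rewrite ler_wpM2l// ?(ltW D0)//.
    (* Column [k] need not be the one chosen by the rule: a hypothetical pivot on it bounds its
       entries by gamma / delta. *)
    have [r' lv'] := leaving_of_negative_cost fB ck; have [a_gt0 _] := lv'.
    have [B'' B''E] := exchange_basis (lt0r_neq0 a_gt0).
    have [dt' _ ta_le'] := exchange_bounds fB lv' B''E.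
    have {}t0 := lt_le_trans d0 dt'.
    apply: pnorm_edge_le => [|i]; first by rewrite ler_pdivlMr// mul1r.
    have := ta_le' i; rewrite normrM (gtr0_norm t0) => H.
    rewrite ler_pdivlMr// (le_trans _ H)// mulrC ler_wpM2r//.
  apply: (@le_trans _ _ (\sum_k D * W * xs (nvar B k) 0)); first exact: ler_sum.
  have -> : W * (m%:R * gamma) * D = D * W * (m%:R * gamma) by ring.
  rewrite -mulr_sumr ler_wpM2l//; first by rewrite mulr_ge0// ltW.
  (* Passing to the sum over all variables allows a split along the optimal basis, where only m
     terms survive. *)
  apply: (@le_trans _ _ (\sum_j xs j 0)).
    by rewrite (sum_bvar_nvar B) lerDr sumr_ge0.
  rewrite (sum_bvar_nvar Bs) [X in _ + X]big1 ?addr0; last first.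
    by move=> k _; exact: basic_solution_nvar.
  by apply: sum_ord_le => i; exact: basic_solution_le.
have K0 : 0 < rate := lt_le_trans ltr01 rate_ge1.
have : gap B <= rate * - (theta * cbar c B s 0).
  apply: (le_trans gap_le); apply: le_trans (ler_wpM2l (ltW K0) decrease).
  by rewrite [leRHS]mulrA ler_wpM2r ?rate_factor// ltW.
rewrite -ler_pdivrMl// mulrBl mul1r.
lra.
Qed.

(** * Counting iterations by phases *)

Lemma pnorm_simplex_solves_optimal t B : feasible_basis b B ->
  optimal_dictionary c B -> pnorm_simplex_solves p b c t B.
Proof.
by move=> fB oB; case: t => [|t]; left; split=> //;
  exact: optimal_dictionary_optimal.
Qed.

(** Runs [t] iterations, then hands over to [run]. The latter covers every basis with a small gap,
    since ties leave the basis reached undetermined; an earlier optimum ends the run. *)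
Lemma pnorm_simplex_run t u B g : feasible_basis b B -> gap B <= g ->
  (forall B', feasible_basis b B' -> gap B' <= (1 - rate^-1) ^+ t * g ->
     pnorm_simplex_solves p b c u B') ->
  pnorm_simplex_solves p b c (t + u) B.
Proof.
elim: t B g => [|t IH] B g fB gB run.
  by apply: run => //; rewrite expr0 mul1r.
have [oB|noB] := pselect (optimal_dictionary c B).
  exact: pnorm_simplex_solves_optimal.
right; split=> //; split; first exact: pnorm_entering_exists.
move=> s es; split; first by case: es => cs _; exact: leaving_of_negative_cost.
move=> r lv; have [a_gt0 _] := lv.
have [B' B'E] := exchange_basis (lt0r_neq0 a_gt0); exists B'; split=> //.
apply: (IH _ ((1 - rate^-1) * g)); first exact: exchange_feasible lv B'E.
  apply: (le_trans (gap_contraction fB es lv B'E)); rewrite ler_wpM2l//.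
  by rewrite subr_ge0 invf_le1 ?rate_ge1// (lt_le_trans ltr01 rate_ge1).
by move=> B''; rewrite mulrA -exprSr; exact: run.
Qed.

Hypothesis log_pos : m = 1%N -> delta < gamma.

Let T := `|Num.ceil (rate * ln (m%:R * gamma / delta))|%N.

Lemma log_gt0 : 0 < ln (m%:R * gamma / delta).
Proof.
have d0 := delta_gt0; have dg := delta_le_gamma.
rewrite ln_gt0// ltr_pdivlMr// mul1r.
have [m1|m1] := eqVneq m 1%N.
  by rewrite [X in X%:R]m1 mul1r; exact: log_pos.
by rewrite (le_lt_trans dg)// ltr_pMl ?gamma_gt0// ltr1n ltn_neqAle eq_sym m1 m_gt0.
Qed.

(** From 1 - 1/K < exp(-1/K) and T >= K log(m gamma / delta). Strictness survives the power because
    positivity of the logarithm gives T > 0. *)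
Lemma expr_rate_lt : (1 - rate^-1) ^+ T < delta / (m%:R * gamma).
Proof.
have d0 := delta_gt0; have g0 := gamma_gt0; have L0 := log_gt0.
have m0 : 0 < m%:R :> R by rewrite ltr0n m_gt0.
have K0 : 0 < rate := lt_le_trans ltr01 rate_ge1.
have C0 : 0 < Num.ceil (rate * ln (m%:R * gamma / delta)).
  by rewrite ceil_gt0 mulr_gt0.
apply: (@lt_le_trans _ _ (expR (- rate^-1) ^+ T)).
  rewrite ltrXn2r ?nnegrE//.
  - by rewrite /T -lt0n absz_gt0 gt_eqF.
  - by rewrite subr_ge0 invf_le1 ?rate_ge1.
  - by rewrite expR_gt1Dx// oppr_eq0 invr_eq0 gt_eqF.
rewrite -expRM_natl -[leRHS]lnK; last by rewrite posrE divr_gt0// mulr_gt0.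
rewrite ler_expR -[_ / _]invf_div lnV ?posrE ?divr_gt0 ?mulr_gt0//.
rewrite mulrN lerN2 ler_pdivlMr// mulrC.
by rewrite (le_trans (ceil_ge _))// /T natr_absz gtr0_norm.
Qed.

Lemma pnorm_simplex_bound B : feasible_basis b B ->
  pnorm_simplex_solves p b c ((n - m) * T)%N B.
Proof.
have [s [s_ge0 card_s gapE]] := complementary_slack.
have d0 := delta_gt0; have g0 := gamma_gt0.
have m0 : 0 < m%:R :> R by rewrite ltr0n m_gt0.
(* The indices still allowed to be basic when the gap is at most g. *)
pose pending g := [set j | ((0 < s j 0) && (s j 0 * delta <= g))%R]%SET.
(* The witness is the basic index with the largest slack, which is at least the average share of the
   gap. *)
have witness B' : feasible_basis b B' -> 0 < gap B' ->
    exists2 j, j \in pending (gap B') & gap B' <= m%:R * gamma * s j 0.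
  move=> fB' gap_gt0; have [i _ imax] := @arg_maxP _ _ _ (Ordinal m_gt0) xpredT
    (fun i => s (bvar B' i) 0) isT.
  have gap_sum : gap B' = \sum_i s (bvar B' i) 0 * bbar b B' i 0.
    rewrite /gap gapE ?mul_basic_solution// (sum_bvar_nvar B').
    rewrite [X in _ + X]big1 ?addr0 => [|k _].
      by apply: eq_bigr => l _; rewrite basic_solution_bvar.
    by rewrite basic_solution_nvar mulr0.
  have gap_le : gap B' <= m%:R * gamma * s (bvar B' i) 0.
    rewrite gap_sum -mulrA; apply: sum_ord_le => l; rewrite mulrC ler_pM//; last exact: imax.
    by case/andP: (bbar_bounds l fB').
  exists (bvar B' i) => //; rewrite inE; apply/andP; split.
    have := lt_le_trans gap_gt0 gap_le; rewrite pmulr_rgt0// mulr_gt0//.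
  rewrite gap_sum (bigD1 i)//= -[leLHS]addr0 lerD//.
    by rewrite ler_wpM2l//; case/andP: (bbar_bounds i fB').
  by rewrite sumr_ge0// => l _; rewrite mulr_ge0.
(* Each phase removes at least one pending index, so induction on a bound for their number pays [T]
   iterations per index. *)
suff main l B' : feasible_basis b B' -> (#|pending (gap B')| <= l)%N ->
    pnorm_simplex_solves p b c (l * T)%N B'.
  move=> fB; apply: main => //; apply: leq_trans card_s.
  by apply/subset_leq_card/fintype.subsetP => j; rewrite !inE => /andP[].
elim: l B' => [|l IH] {}B fB card_pending.
all: have [gB0|gB0] := leP (gap B) 0;
  first exact/pnorm_simplex_solves_optimal/optimal_of_gap0.
all: have [j jP gap_le] := witness B fB gB0.
  (* With nothing pending the gap cannot be positive, as the witness would be pending. *)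
  by move: card_pending; rewrite leqn0 cards_eq0 => /eqP P0; rewrite P0 inE in jP.
rewrite mulSn; apply: (pnorm_simplex_run fB (lexx _)) => B' fB' gap'.
apply: IH => //; rewrite -ltnS; apply: leq_trans card_pending.
have gap'_lt : gap B' < delta / (m%:R * gamma) * gap B.
  by rewrite (le_lt_trans gap')// ltr_pM2r// expr_rate_lt.
have gap'_j : gap B' < s j 0 * delta.
  rewrite (lt_le_trans gap'_lt)// mulrAC ler_pdivrMr ?mulr_gt0//.
  by rewrite -mulrA mulrCA ler_pM2l// mulrC.
(* After the phase, gap' < s_j delta <= gap: [j] is no longer pending and no new index becomes
   so. *)
apply: proper_card; apply/properP; split; last first.
  by exists j => //; rewrite inE negb_and -ltNge gap'_j orbT.
apply/fintype.subsetP => i; rewrite !inE => /andP[-> /= /le_trans]; apply.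
move: jP; rewrite inE => /andP[_]; apply: le_trans.
exact: ltW.
Qed.

End Convergence.

Theorem theorem8 (R : realType) (p : R) (m n : nat) (A : 'M[R]_(m, n))
    (b : 'cV[R]_m) (c x0 : 'cV[R]_n) (B0 : lp_basis A)
    (zstar gamma delta : R)
    (p_ge1 : 1 <= p)
    (rankA : \rank A = m)
    (feasB0 : feasible_basis b B0)
    (x0E : x0 = basic_solution b B0)
    (optval : has_optimal_value A b c zstar)
    (x0_nonopt : zstar < objective c x0)
    (nondeg : nondegenerate_lp A b)
    (gamma_max : is_maximum (bfs_positive_component A b) gamma)
    (delta_min : is_minimum (bfs_positive_component A b) delta)
    (* for m = 1 and gamma = delta the logarithm below vanishes and the bound
       is 0, although x0 is not optimal *)
    (log_pos : m = 1%N -> delta < gamma) :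
  exists t : nat,
    t%:Z <= (n - m)%:Z *
      Num.ceil (m%:R `^ (1 + p^-1) * (gamma ^+ 2 / delta ^+ 2) *
                ln (m%:R * gamma / delta)) /\
    pnorm_simplex_solves p b c t B0.
Proof.
exists ((n - m) * `|Num.ceil (rate p m gamma delta *
  ln (m%:R * gamma / delta))|)%N; split.
  (* The absolute value that turns the ceiling into a natural number changes nothing, since the
     logarithm is positive. *)
  rewrite PoszM gez0_abs// ceil_ge0 (lt_le_trans (ltrN10 _))//.
  rewrite mulr_ge0 ?(le_trans ler01 (rate_ge1 p_ge1 gamma_max delta_min))//.
  exact/ltW/(log_gt0 gamma_max delta_min log_pos).
exact: (pnorm_simplex_bound p_ge1 optval nondeg gamma_max delta_min log_pos feasB0).
Qed.
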